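(* For every partition $\Pi$ of the interval $[0,T]$, the lower value function $V^\Pi$ and the upper value function $U^\Pi$ along $\Pi$ are deterministic, i.e., for all $(t,x)\in[0,T]\times\mathbb R^d$, $$V^\Pi(t,x)=E[V^\Pi(t,x)]\quad\text{and}\quad U^\Pi(t,x)=E[U^\Pi(t,x)],\qquad P\text{-a.s.}$$
   Context: Setting. $T>0$ is fixed, $U,V$ are compact metric spaces, $f:[0,T]\times\mathbb R^d\times U\times V\to\mathbb R^d$ is bounded, continuous, and Lipschitz in $x$ uniformly with respect to $(t,u,v)$, and $g:\mathbb R^d\to\mathbb R$ is bounded and Lipschitz. Probability space. $(\Omega,\mathcal F,P)=\big(([0,1]^2)^{\mathbb N},\mathcal B([0,1]^2)^{\otimes\mathbb N},\lambda_2^{\otimes\mathbb N}\big)$, with $\mathbb N$ the positive integers and $\lambda_2$ two-dimensional Lebesgue (Borel) measure on $[0,1]^2$. The coordinate maps are $\zeta_j=(\zeta_{j,1},\zeta_{j,2}):\Omega\to[0,1]^2$, $j\ge1$. Put $\mathcal G_j=\sigma(\zeta_{j,1})$, $\mathcal H_j=\sigma(\zeta_{j,2})$, $\mathcal F_j=\sigma(\zeta_1,\dots,\zeta_j)$ for $j\ge1$, and $\mathcal F_0$ the trivial $\sigma$-field. $\mathbb F=(\mathcal F_j)$; a random time $\tau:\Omega\to\{0,1,2,\dots\}$ is an $\mathbb F$-stopping time if $\{\tau=j\}\in\mathcal F_j$ for all $j\ge0$. Admissible controls. Let $\Pi=\{0=t_0<\dots<t_n=T\}$. For a sub-$\sigma$-field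 $\mathcal K\subset\mathcal F$, $L^0_{\mathcal K}(a,b;E)$ denotes the (jointly) measurable $E$-valued processes $(u_s)$ on the time interval from $a$ to $b$ with $u_s$ $\mathcal K$-measurable for every $s$. $\mathcal U^\Pi_{0,T}$ is the set of $u\in L^0_{\mathcal F}(0,T;U)$ such that for each $1\le j\le n$, $u|_{[t_{j-1},t_j)}=\sum_{k\ge1}I_{\Gamma_{j,k}}u^{j,k}$ (i.e. $u=u^{j,k}$ on $\Gamma_{j,k}$), where $(\Gamma_{j,k})_{k\ge1}\subset\mathcal F_{j-1}$ is a partition of $\Omega$ and $u^{j,k}\in L^0_{\mathcal G_j}(t_{j-1},t_j;U)$. $\mathcal V^\Pi_{0,T}$ is defined in the same way with $V$ and $\mathcal H_j$ in place of $U$ and $\mathcal G_j$. For $0\le t\le t_l\in\Pi$, $\mathcal U^\Pi_{t,t_l}$ and $\mathcal V^\Pi_{t,t_l}$ are the sets of restrictions of these controls to $[t,t_l]$. Dynamics. For $(u,v)\in\mathcal U^\Pi_{t,T}\times\mathcal V^\Pi_{t,T}$, $X^{t,x,u,v}$ is the unique pathwise solution of $X_s=x+\int_t^sf(r,X_r,u_r,v_r)\,dr$, $s\in[t,T]$. NAD-strategies. $\mathcal B^\Pi_{t,t_l}$ is the set of maps $\beta:\mathcal U^\Pi_{t,t_l}\to\mathcal V^\Pi_{t,t_l}$ such that for every $\mathbb F$-stopping time $\tau:\Omega\to\{0,\dots,n-1\}$ and all $u,u'\in\mathcal U^\Pi_{t,t_l}$ with $u=u'$ $dsdP$-a.s.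 on $\{(s,\omega):t\le s\le t_{\tau(\omega)}\}$, one has $\beta(u)=\beta(u')$ $dsdP$-a.s. on $\{(s,\omega):t\le s\le t_{\tau(\omega)+1}\}$ (times restricted to $[t,t_l]$). $\mathcal A^\Pi_{t,t_l}$ is the symmetric set of maps $\alpha:\mathcal V^\Pi_{t,t_l}\to\mathcal U^\Pi_{t,t_l}$. For every $(\alpha,\beta)\in\mathcal A^\Pi_{t,t_l}\times\mathcal B^\Pi_{t,t_l}$ there is a $dsdP$-a.s. unique $(u,v)\in\mathcal U^\Pi_{t,t_l}\times\mathcal V^\Pi_{t,t_l}$ with $\alpha(v)=u$, $\beta(u)=v$; one sets $X^{t,x,\alpha,\beta}:=X^{t,x,u,v}$. Value functions along $\Pi$. For $t_i\le t<t_{i+1}$ ($0\le i\le n-1$), the a priori $\mathcal F_i$-measurable random variables $$V^\Pi(t,x)=\operatorname{esssup}_{\alpha\in\mathcal A^\Pi_{t,T}}\operatorname{essinf}_{\beta\in\mathcal B^\Pi_{t,T}}E[g(X_T^{t,x,\alpha,\beta})|\mathcal F_i],\quad U^\Pi(t,x)=\operatorname{essinf}_{\beta\in\mathcal B^\Pi_{t,T}}\operatorname{esssup}_{\alpha\in\mathcal A^\Pi_{t,T}}E[g(X_T^{t,x,\alpha,\beta})|\mathcal F_i],$$ and $V^\Pi(T,x)=U^\Pi(T,x)=g(x)$. *)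

(* Defs.v *)
From HB Require Import structures.
From mathcomp Require Import all_boot all_order all_algebra.
From mathcomp Require Import all_classical all_reals all_analysis.

Set Implicit Arguments.
Unset Strict Implicit.
Unset Printing Implicit Defensive.

Import Order.TTheory GRing.Theory Num.Theory.
Import numFieldNormedType.Exports.

Local Open Scope classical_set_scope.
Local Open Scope ring_scope.

HB.instance Definition _ (R : realType) := isPointed.Build {i01 R} 0%:i01.

Section canonical_space.
Variable R : realType.

Definition unit_embed (x : {i01 R}) : measurableTypeR R := x%:num.

(* [0,1] with the trace of the Borel sigma-field of R *)
Definition unit_interval : Type := g_sigma_algebra_preimageType unit_embed.

Definition unit_square : Type := (unit_interval * unit_interval)%type.

Definition lambda2 (B : set unit_square) : \bar R :=
  (@lebesgue_measure R \x @lebesgue_measure R)%E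
    [set (unit_embed z.1, unit_embed z.2) | z in B].

(* Sequences are indexed from 0: the coordinate [zeta k] below is the
   mathematical zeta_(k+1), so that F_j = sigma(zeta 0, ..., zeta j.-1), and the
   fields written G_j, H_j for j >= 1 are [Gfield j.-1], [Hfield j.-1]. *)
Definition Omega : Type := g_sigma_algebraType
  (\bigcup_(k : nat)
     preimage_set_system setT (fun w : nat -> unit_square => w k) measurable).

Definition zeta (k : nat) (w : Omega) : unit_square := w k.

Definition Ffield (j : nat) : set_system Omega :=
  <<s \bigcup_(k in `I_j) preimage_set_system setT (zeta k) measurable >>.

Definition Gfield (k : nat) : set_system Omega :=
  preimage_set_system setT (fun w => (zeta k w).1) measurable.

Definition Hfield (k : nat) : set_system Omega :=
  preimage_set_system setT (fun w => (zeta k w).2) measurable.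

(* P is the infinite product of copies of lambda2; the values on cylinders
   determine a probability on Omega uniquely. *)
Definition is_product_measure (P : probability Omega R) : Prop :=
  forall (n : nat) (B : nat -> set unit_square),
    (forall k, measurable (B k)) ->
    P (\bigcap_(k in `I_n) zeta k @^-1` B k) = (\prod_(k < n) lambda2 (B k))%E.

Definition stopping_time (tau : Omega -> nat) : Prop :=
  forall j, Ffield j (tau @^-1` [set j]).

Definition rv_wrt (K : set_system Omega) (Y : Omega -> R) : Prop :=
  forall B : set (measurableTypeR R), measurable B -> K (Y @^-1` B).

(* Z is a version of E[Y | K] *)
Definition is_condexp (P : probability Omega R) (K : set_system Omega)
    (Y Z : Omega -> R) : Prop :=
  [/\ rv_wrt K Z,
      P.-integrable setT (EFin \o Z) &
      forall A, K A ->
        (\int[P]_(w in A) (Z w)%:E = \int[P]_(w in A) (Y w)%:E)%E].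

(* Y is a K-measurable version of the P-essential supremum of the family S;
   minimality is among all random variables on Omega. *)
Definition is_esssup (P : probability Omega R) (K : set_system Omega)
    (S : set (Omega -> R)) (Y : Omega -> R) : Prop :=
  [/\ rv_wrt K Y,
      forall X, S X -> {ae P, forall w, X w <= Y w} &
      forall Z, rv_wrt measurable Z ->
        (forall X, S X -> {ae P, forall w, X w <= Z w}) ->
        {ae P, forall w, Y w <= Z w}].

Definition is_essinf (P : probability Omega R) (K : set_system Omega)
    (S : set (Omega -> R)) (Y : Omega -> R) : Prop :=
  [/\ rv_wrt K Y,
      forall X, S X -> {ae P, forall w, Y w <= X w} &
      forall Z, rv_wrt measurable Z ->
        (forall X, S X -> {ae P, forall w, Z w <= X w}) ->
        {ae P, forall w, Z w <= Y w}].

End canonical_space.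

Record time_partition (R : realType) (T : R) := Partition {
  mesh_size : nat;
  mesh : nat -> R; (* only the values at 0, ..., mesh_size matter *)
  mesh0 : mesh 0%N = 0;
  mesh_last : mesh mesh_size = T;
  mesh_lt : forall j, (j < mesh_size)%N -> mesh j < mesh j.+1
}.

Section controls.
Variables (R : realType) (T : R) (Pi : time_partition T).
Local Notation Omega := (Omega R).
Local Notation n := (mesh_size Pi).
Local Notation tm := (mesh Pi).

(* L^0_K(a, b; E). Processes are total functions of time whose values outside
   [a, b] are irrelevant. *)
Definition L0 (E : topologicalType) (K : set_system Omega) (a b : R) :
    set (R -> Omega -> E) :=
  [set u |
    (forall B : set E, <<s @open E >> B ->
       measurable [set z : measurableTypeR R * Omega |
                     a <= z.1 <= b /\ B (u z.1 z.2)]) /\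
    (forall (s : R) (B : set E), a <= s <= b -> <<s @open E >> B ->
       K (u s @^-1` B))].

(* With K = Gfield this is U^Pi_{0,T}, with K = Hfield it is V^Pi_{0,T}. *)
Definition controls (E : topologicalType) (K : nat -> set_system Omega) :
    set (R -> Omega -> E) :=
  [set u | L0 measurable 0 T u /\
    forall j, (j < n)%N ->
      exists (Gamma : nat -> set Omega) (w : nat -> R -> Omega -> E),
        [/\ forall k, Ffield j (Gamma k),
            trivIset setT Gamma,
            \bigcup_k Gamma k = setT,
            forall k, L0 (K j) (tm j) (tm j.+1) (w k) &
            forall k s om, tm j <= s < tm j.+1 -> Gamma k om ->
              u s om = w k s om]].

(* Restrictions to [t, T] of elements of [controls]; again only the values on
   [t, T] are relevant. *)
Definition controls_from (E : topologicalType) (K : nat -> set_system Omega)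
    (t : R) : set (R -> Omega -> E) :=
  [set u | exists2 u0, controls K u0 &
     forall s, t <= s <= T -> u s = u0 s].

Variable P : probability Omega R.

(* u = u' ds dP-a.s. on {(s, w) : t <= s <= b w} *)
Definition ae_eq_upto (E : Type) (t : R) (b : Omega -> R)
    (u u' : R -> Omega -> E) : Prop :=
  {ae (@lebesgue_measure R \x P)%E, forall z : measurableTypeR R * Omega,
     t <= z.1 <= b z.2 -> u z.1 z.2 = u' z.1 z.2}.

(* NAD-strategies on [t, T] from K1-controls to K2-controls. The second
   condition makes [beta] a map on restrictions to [t, T]. *)
Definition strategies (E1 E2 : topologicalType)
    (K1 K2 : nat -> set_system Omega) (t : R) :
    set ((R -> Omega -> E1) -> (R -> Omega -> E2)) :=
  [set beta |
    [/\ forall u, controls_from K1 t u -> controls_from K2 t (beta u),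
        forall u u', controls_from K1 t u -> controls_from K1 t u' ->
          (forall s, t <= s <= T -> u s = u' s) ->
          forall s, t <= s <= T -> beta u s = beta u' s &
        forall tau : Omega -> nat,
          (forall w, (tau w < n)%N) -> stopping_time tau ->
          forall u u', controls_from K1 t u -> controls_from K1 t u' ->
            ae_eq_upto t (fun w => tm (tau w)) u u' ->
            ae_eq_upto t (fun w => tm (tau w).+1) (beta u) (beta u')]].

End controls.

Section values.
Variables (R : realType) (d : nat) (U V : metricType R) (T : R).
Variable f : R -> 'rV[R]_d.+1 -> U -> V -> 'rV[R]_d.+1.
Variable g : 'rV[R]_d.+1 -> R.
Variable P : probability (Omega R) R.
Variable Pi : time_partition T.
Local Notation Omega := (Omega R).

Definition is_trajectory (t : R) (x : 'rV[R]_d.+1) (u : R -> Omega -> U)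
    (v : R -> Omega -> V) (X : R -> Omega -> 'rV[R]_d.+1) : Prop :=
  forall w,
    {within `[t, T], continuous (fun s => X s w)} /\
    forall s, t <= s <= T -> forall k,
      X s w ord0 k = x ord0 k +
        \int[@lebesgue_measure R]_(r in `[t, s])
          (f r (X r w) (u r w) (v r w) ord0 k).

Definition Ucontrols (t : R) : set (R -> Omega -> U) :=
  controls_from Pi (@Gfield R) t.

Definition Vcontrols (t : R) : set (R -> Omega -> V) :=
  controls_from Pi (@Hfield R) t.

Definition Astrategies (t : R) :
    set ((R -> Omega -> V) -> (R -> Omega -> U)) :=
  strategies Pi P (@Hfield R) (@Gfield R) t.

Definition Bstrategies (t : R) :
    set ((R -> Omega -> U) -> (R -> Omega -> V)) :=
  strategies Pi P (@Gfield R) (@Hfield R) t.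

(* All versions of E[g(X_T^{t,x,alpha,beta}) | F_i]; (u, v) is the pair of
   controls, unique ds dP-a.s., with alpha(v) = u and beta(u) = v, equalities
   between controls being understood ds dP-a.s. *)
Definition payoff (i : nat) (t : R) (x : 'rV[R]_d.+1)
    (alpha : (R -> Omega -> V) -> (R -> Omega -> U))
    (beta : (R -> Omega -> U) -> (R -> Omega -> V)) : set (Omega -> R) :=
  [set Z | exists u v X,
    [/\ Ucontrols t u /\ Vcontrols t v,
        ae_eq_upto P t (fun=> T) (alpha v) u,
        ae_eq_upto P t (fun=> T) (beta u) v,
        is_trajectory t x u v X &
        is_condexp P (Ffield i) (fun w => g (X T w)) Z]].

(* W is a version of V^Pi(t, x). *)
Definition is_lower_value (t : R) (x : 'rV[R]_d.+1) (W : Omega -> R) : Prop :=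
  (t = T /\ W = cst (g x)) \/
  exists i : nat, [/\ (i < mesh_size Pi)%N, mesh Pi i <= t < mesh Pi i.+1 &
    is_esssup P (Ffield i)
      [set Y | exists2 alpha, Astrategies t alpha &
         is_essinf P (Ffield i)
           [set Z | exists2 beta, Bstrategies t beta &
              payoff i t x alpha beta Z] Y] W].

(* W is a version of U^Pi(t, x). *)
Definition is_upper_value (t : R) (x : 'rV[R]_d.+1) (W : Omega -> R) : Prop :=
  (t = T /\ W = cst (g x)) \/
  exists i : nat, [/\ (i < mesh_size Pi)%N, mesh Pi i <= t < mesh Pi i.+1 &
    is_essinf P (Ffield i)
      [set Y | exists2 beta, Bstrategies t beta &
         is_esssup P (Ffield i)
           [set Z | exists2 alpha, Astrategies t alpha &
              payoff i t x alpha beta Z] Y] W].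

End values.

(* Main.v *)
Require Import Defs.
From HB Require Import structures.
From mathcomp Require Import all_boot all_order all_algebra.
From mathcomp Require Import all_classical all_reals all_analysis.
From mathcomp Require Import measurable_realfun.
From mathcomp Require Import ring lra.
Import Order.TTheory GRing.Theory Num.Theory.
Import numFieldNormedType.Exports.
Local Open Scope classical_set_scope.
Local Open Scope ring_scope.

Set Implicit Arguments.
Unset Strict Implicit.
Unset Printing Implicit Defensive.

(** The value along a partition does not change when the noise is transported
by a symmetry of the game, and there are enough such symmetries to force an
invariant random variable to be constant.

A symmetry of the noise ([noise_symmetry]) is a measurable, measure-preserving
involution [h] of the probability space that maps each of the fields F_j, G_j
and H_j into itself.  Composition with [h] turns admissible controls into
admissible controls, trajectories into trajectories, and versions of E[Y | F_i]
into versions of E[Y o h | F_i]; conjugation by [h] turns NAD-strategies into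
NAD-strategies.  So the family of random variables whose essential supremum
(or infimum) is the value is stable under composition with [h], and uniqueness
of essential suprema gives W o h = W almost surely ([esssup_invariant],
[essinf_invariant]).

The symmetries come from seeing [0, 1] as a circle: for a in Omega, let
[reflect_noise (a, w)] reflect every component x of every coordinate of w
into a' - x mod 1, where a' is the corresponding component of a.  As the two
components of each coordinate are moved separately, G_j and H_j are respected.
Now let W be invariant under all these reflections.  By Fubini's theorem, for
almost every w, the identity W (reflect_noise (a, w)) = W w holds for almost
every a.  But for fixed w the point [reflect_noise (a, w)] runs over Omega with
law P when a does.  Hence W equals the constant W w almost surely
([ae_constant_of_invariant]). *)

(** * Measure-preserving involutions *)

Lemma measurable_preimageT d d' (X : measurableType d) (Y : measurableType d')
    (h : X -> Y) (A : set Y) :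
  measurable_fun setT h -> measurable A -> measurable (h @^-1` A).
Proof. by move=> mh mA; rewrite -[X in measurable X]setTI; exact: mh. Qed.

Section measure_preserving_involution.
Context d (T : measurableType d) (R : realType).
Variables (mu : {measure set T -> \bar R}) (h : T -> T).
Hypotheses (hK : involutive h) (mh : measurable_fun setT h).
Hypothesis mu_h : forall A, measurable A -> mu (h @^-1` A) = mu A.

Import HBNNSimple.

Let nnsfun_comp (k : {nnsfun T >-> R}) :
  exists k' : {nnsfun T >-> R}, forall x, k' x = k (h x).
Proof.
have mk : measurable_fun setT (k \o h) by exact: measurableT_comp.
have fk : finite_set (range (k \o h)).
  by apply: (sub_finite_set _ (fimfunP k)) => _ [x _ <-]; exists (h x).
have k0 x : 0 <= (k \o h) x by exact: fun_ge0.
pose mk1 := isMeasurableFun.Build _ _ _ _ _ mk.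
pose mk2 := FiniteImage.Build _ _ _ fk.
pose mk3 := isNonNegFun.Build _ _ _ k0.
pose k' : {nnsfun _ >-> _} := HB.pack (k \o h) mk1 mk2 mk3.
by exists k'.
Qed.

Let ge0_integral_comp_le (f : T -> \bar R) : (forall x, 0 <= f x)%E ->
  (\int[mu]_x f (h x) <= \int[mu]_x f x)%E.
Proof.
move=> f0; rewrite !ge0_integralTE//.
apply: ge_ereal_sup => _ [k /= kf <-].
have [k' k'E] := nnsfun_comp k.
apply: ereal_sup_ubound; exists k' => /=.
  by move=> x; rewrite k'E -{2}(hK x); exact: kf.
have sint (l : {nnsfun T >-> R}) : sintegral mu l = (\int[mu]_x (l x)%:E)%E.
  by rewrite integral_nnsfun// patch_setT.
rewrite !sint; under eq_integral do rewrite k'E.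
have := @ge0_integral_pushforward _ _ _ _ R _ mh mu setT (EFin \o k)
  measurableT.
move=> /(_ _ _); rewrite preimage_setT /= => <- //.
- apply: eq_measure_integral => A mA _; exact: mu_h.
- by apply/measurable_EFinP; exact: measurable_funP.
- by move=> y _; rewrite lee_fin; exact: fun_ge0.
Qed.

Let ge0_integral_comp (f : T -> \bar R) : (forall x, 0 <= f x)%E ->
  (\int[mu]_x f (h x) = \int[mu]_x f x)%E.
Proof.
move=> f0; apply/eqP; rewrite eq_le ge0_integral_comp_le//=.
have := @ge0_integral_comp_le (f \o h) (fun x => f0 (h x)).
by apply: le_trans; rewrite le_eqVlt; apply/orP; left; apply/eqP;
  apply: eq_integral => x _ /=; rewrite hK.
Qed.

(** Stated for arbitrary [f], since it is applied to the terminal payoff as a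
mere function of the noise: the simple functions below [f o h] are the
compositions with [h] of those below [f]. *)
Lemma integral_involution (f : T -> \bar R) (A : set T) :
  (\int[mu]_(x in h @^-1` A) f (h x) = \int[mu]_(x in A) f x)%E.
Proof.
rewrite integral_mkcond [RHS]integral_mkcond.
rewrite [LHS](_ : _ = \int[mu]_x (f \_ A) (h x))%E; last first.
  apply: eq_integral => x _; rewrite !patchE.
  by congr (if _ then _ else _); apply/idP/idP; rewrite !inE.
rewrite integralE [RHS]integralE; congr (_ - _)%E.
  rewrite -(ge0_integral_comp (funepos_ge0 (f \_ A))).
  by apply: eq_integral => x _; rewrite !funeposE.
rewrite -(ge0_integral_comp (funeneg_ge0 (f \_ A))).
by apply: eq_integral => x _; rewrite !funenegE.
Qed.

Lemma ae_involution (Q : T -> Prop) :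
  {ae mu, forall x, Q x} -> {ae mu, forall x, Q (h x)}.
Proof.
move=> [N [mN N0 QN]]; exists (h @^-1` N); split.
- exact: measurable_preimageT.
- by rewrite mu_h.
- by move=> x /= nQ; apply: QN.
Qed.

End measure_preserving_involution.

(** * Equivariance of the game under a symmetry of the noise *)

Record noise_symmetry (R : realType) (P : probability (Omega R) R)
    (h : Omega R -> Omega R) : Prop := NoiseSymmetry {
  noise_symK : involutive h;
  noise_sym_measurable : forall A, measurable A -> measurable (h @^-1` A);
  noise_sym_preserving : forall A, measurable A -> P (h @^-1` A) = P A;
  noise_sym_F : forall j A, Ffield j A -> Ffield j (h @^-1` A);
  noise_sym_G : forall k A, Gfield k A -> Gfield k (h @^-1` A);
  noise_sym_H : forall k A, Hfield k A -> Hfield k (h @^-1` A)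
}.

Section equivariance.
Variables (R : realType) (P : probability (Omega R) R) (h : Omega R -> Omega R).
Hypothesis hS : noise_symmetry P h.
Local Notation Omega := (Omega R).

Let hK : involutive h := noise_symK hS.

Let mh : measurable_fun setT h.
Proof. by move=> _ A mA; rewrite setTI; exact: (noise_sym_measurable hS). Qed.

Let Ph := noise_sym_preserving hS.

Let id_h (z : measurableTypeR R * Omega) : measurableTypeR R * Omega :=
  (z.1, h z.2).

Let measurable_id_h : measurable_fun setT id_h.
Proof.
apply: measurable_fun_pair; first exact: measurable_fst.
exact: (measurableT_comp mh measurable_snd).
Qed.

Let id_h_preserving (A : set (measurableTypeR R * Omega)) : measurable A ->
  ((@lebesgue_measure R \x P) (id_h @^-1` A) = (@lebesgue_measure R \x P) A)%E.
Proof.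
move=> mA; apply: eq_integral => s _ /=.
have -> : xsection (id_h @^-1` A) s = h @^-1` (xsection A s).
  by apply/seteqP; split=> w; rewrite /xsection /= !inE.
exact: Ph (measurable_xsection _ mA).
Qed.

Definition twist (E : Type) (u : R -> Omega -> E) : R -> Omega -> E :=
  fun s w => u s (h w).

Definition twist_strategy (E1 E2 : Type)
    (beta : (R -> Omega -> E1) -> (R -> Omega -> E2)) :=
  fun u => twist (beta (twist u)).

Lemma twistK (E : Type) : involutive (@twist E).
Proof. by move=> u; apply/funext => s; apply/funext => w; rewrite /twist hK. Qed.

Lemma twist_strategyK (E1 E2 : Type) : involutive (@twist_strategy E1 E2).
Proof. by move=> b; apply/funext => u; rewrite /twist_strategy !twistK. Qed.

Lemma twist_L0 (E : topologicalType) (K : set_system Omega) a b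
    (u : R -> Omega -> E) :
  (forall A, K A -> K (h @^-1` A)) -> L0 K a b u -> L0 K a b (twist u).
Proof.
move=> hKK [mu uK]; split=> [B mB|s B sab mB].
  have := measurable_id_h measurableT (mu B mB).
  by rewrite setTI.
exact: hKK (uK s B sab mB).
Qed.

Variables (T : R) (Pi : time_partition T).

Lemma twist_controls (E : topologicalType) (K : nat -> set_system Omega)
    (u : R -> Omega -> E) :
  (forall k A, K k A -> K k (h @^-1` A)) ->
  controls Pi K u -> controls Pi K (twist u).
Proof.
move=> hKK [u0 uj]; split.
  by apply: twist_L0 => // A; exact: (noise_sym_measurable hS).
move=> j jn; have [Gamma [w [FG tG UG Lw uw]]] := uj j jn.
exists (fun k => h @^-1` Gamma k), (fun k => twist (w k)); split.
- by move=> k; exact: (noise_sym_F hS).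
- apply/trivIsetP => k l _ _ kl; rewrite -preimage_setI.
  by move/trivIsetP : tG => /(_ k l I I kl) ->; rewrite preimage_set0.
- by rewrite -preimage_bigcup UG preimage_setT.
- by move=> k; apply: twist_L0 => // A; exact: hKK.
- by move=> k s om sj Gom; exact: uw.
Qed.

Lemma twist_controls_from (E : topologicalType) (K : nat -> set_system Omega) t
    (u : R -> Omega -> E) :
  (forall k A, K k A -> K k (h @^-1` A)) ->
  controls_from Pi K t u -> controls_from Pi K t (twist u).
Proof.
move=> hKK [u0 cu0 uu0]; exists (twist u0); first exact: twist_controls.
by move=> s ts; apply/funext => w; rewrite /twist uu0.
Qed.

(** The map (s, w) |-> (s, h w) preserves the product of Lebesgue measure and
[P], section by section. *)
Lemma twist_ae_eq_upto (E : Type) t b (u u' : R -> Omega -> E) :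
  ae_eq_upto P t b u u' -> ae_eq_upto P t (b \o h) (twist u) (twist u').
Proof.
move=> uu'.
have := @ae_involution _ _ R (@lebesgue_measure R \x P)%E id_h
  measurable_id_h id_h_preserving _ uu'.
by apply: filterS => -[].
Qed.

(** The nonanticipativity of [beta] is used at the time [tau o h], which is a
stopping time because [h] respects the filtration. *)
Lemma twist_strategies (E1 E2 : topologicalType)
    (K1 K2 : nat -> set_system Omega) t
    (beta : (R -> Omega -> E1) -> (R -> Omega -> E2)) :
  (forall k A, K1 k A -> K1 k (h @^-1` A)) ->
  (forall k A, K2 k A -> K2 k (h @^-1` A)) ->
  strategies Pi P K1 K2 t beta -> strategies Pi P K1 K2 t (twist_strategy beta).
Proof.
move=> hK1 hK2 [b1 b2 b3]; split.
- move=> u cu; apply: twist_controls_from => //; apply: b1.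
  exact: twist_controls_from.
- move=> u u' cu cu' uu' s ts; apply/funext => w.
  rewrite /twist_strategy /twist (b2 _ (twist u')) //.
  + exact: twist_controls_from.
  + exact: twist_controls_from.
  + by move=> r tr; apply/funext => w'; rewrite /twist uu'.
- move=> tau taun tauS u u' cu cu' uu'.
  rewrite (_ : (fun w => _) = (fun w => mesh Pi (tau (h w)).+1) \o h); last first.
    by apply/funext => w /=; rewrite hK.
  apply: twist_ae_eq_upto; apply: (b3 (tau \o h)) => //.
  + by move=> w; exact: taun.
  + by move=> j; exact: (noise_sym_F hS (tauS j)).
  + exact: twist_controls_from.
  + exact: twist_controls_from.
  + exact: twist_ae_eq_upto uu'.
Qed.

Lemma twist_condexp K (Y Z : Omega -> R) :
  (forall A, K A -> K (h @^-1` A)) ->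
  is_condexp P K Y Z -> is_condexp P K (Y \o h) (Z \o h).
Proof.
move=> hKK [ZK Zint ZY]; split.
- by move=> B mB; exact: (hKK _ (ZK B mB)).
- have /integrableP[mZ Zoo] := Zint.
  apply/integrableP; split; first exact: (measurableT_comp mZ mh).
  have := integral_involution hK mh Ph (fun w => `|(Z w)%:E|%E) setT.
  by rewrite preimage_setT => ->.
- move=> A KA; have -> : A = h @^-1` (h @^-1` A).
    by apply/seteqP; split => w /=; rewrite hK.
  rewrite (integral_involution hK mh Ph (EFin \o Z) (h @^-1` A)).
  rewrite (integral_involution hK mh Ph (EFin \o Y) (h @^-1` A)).
  exact/ZY/hKK.
Qed.

(** The two inclusions express that S' is the set of all X o h with X in S,
since h is an involution. *)
Lemma twist_esssup K (S S' : set (Omega -> R)) Y :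
  (forall A, K A -> K (h @^-1` A)) ->
  (forall X, S X -> S' (X \o h)) -> (forall X, S' X -> S (X \o h)) ->
  is_esssup P K S Y -> is_esssup P K S' (Y \o h).
Proof.
move=> hKK SS' S'S [YK Yub Ylub]; split.
- by move=> B mB; exact: (hKK _ (YK B mB)).
- move=> X /S'S /Yub /(ae_involution mh Ph).
  by apply: filterS => w /=; rewrite hK.
- move=> Z mZ Zub.
  have : {ae P, forall w, Y w <= Z (h w)}.
    apply: (Ylub (Z \o h)) => [B mB|X /SS' /Zub /(ae_involution mh Ph)].
      exact: (noise_sym_measurable hS (mZ B mB)).
    by apply: filterS => w /=; rewrite hK.
  by move=> /(ae_involution mh Ph); apply: filterS => w /=; rewrite hK.
Qed.

Lemma twist_essinf K (S S' : set (Omega -> R)) Y :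
  (forall A, K A -> K (h @^-1` A)) ->
  (forall X, S X -> S' (X \o h)) -> (forall X, S' X -> S (X \o h)) ->
  is_essinf P K S Y -> is_essinf P K S' (Y \o h).
Proof.
move=> hKK SS' S'S [YK Ylb Yglb]; split.
- by move=> B mB; exact: (hKK _ (YK B mB)).
- move=> X /S'S /Ylb /(ae_involution mh Ph).
  by apply: filterS => w /=; rewrite hK.
- move=> Z mZ Zlb.
  have : {ae P, forall w, Z (h w) <= Y w}.
    apply: (Yglb (Z \o h)) => [B mB|X /SS' /Zlb /(ae_involution mh Ph)].
      exact: (noise_sym_measurable hS (mZ B mB)).
    by apply: filterS => w /=; rewrite hK.
  by move=> /(ae_involution mh Ph); apply: filterS => w /=; rewrite hK.
Qed.

Variables (d : nat) (U V : metricType R).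
Variable f : R -> 'rV[R]_d.+1 -> U -> V -> 'rV[R]_d.+1.
Variable g : 'rV[R]_d.+1 -> R.
Variables (t : R) (x : 'rV[R]_d.+1).

Lemma twist_Astrategies alpha : Astrategies (U := U) (V := V) P Pi t alpha ->
  Astrategies (U := U) (V := V) P Pi t (twist_strategy alpha).
Proof.
by apply: twist_strategies; [exact: (noise_sym_H hS)|exact: (noise_sym_G hS)].
Qed.

Lemma twist_Bstrategies beta : Bstrategies (U := U) (V := V) P Pi t beta ->
  Bstrategies (U := U) (V := V) P Pi t (twist_strategy beta).
Proof.
by apply: twist_strategies; [exact: (noise_sym_G hS)|exact: (noise_sym_H hS)].
Qed.

(** If (u, v) is the pair of controls selected by (alpha, beta), then the
conjugate strategies select the pair of twisted controls. *)
Lemma twist_payoff i alpha beta Z :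
  payoff f g P Pi i t x alpha beta Z ->
  payoff f g P Pi i t x (twist_strategy alpha) (twist_strategy beta) (Z \o h).
Proof.
move=> [u [v [X [[cu cv] av bu tX EZ]]]].
exists (twist u), (twist v), (twist X); split.
- split; first exact: (twist_controls_from (noise_sym_G hS)).
  exact: (twist_controls_from (noise_sym_H hS)).
- rewrite /twist_strategy twistK; exact: (twist_ae_eq_upto av).
- rewrite /twist_strategy twistK; exact: (twist_ae_eq_upto bu).
- by move=> w; exact: tX.
- exact: (twist_condexp (noise_sym_F hS (j := i)) EZ).
Qed.

Lemma twist_lower_family i Y :
  let S := [set Y | exists2 alpha, Astrategies P Pi t alpha &
         is_essinf P (Ffield i)
           [set Z | exists2 beta, Bstrategies P Pi t beta &
              payoff f g P Pi i t x alpha beta Z] Y] in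
  S Y -> S (Y \o h).
Proof.
move=> S [alpha aA aY]; exists (twist_strategy alpha).
  exact: twist_Astrategies.
apply: twist_essinf aY; first exact: (noise_sym_F hS (j := i)).
- move=> Z [beta bB bZ]; exists (twist_strategy beta).
    exact: twist_Bstrategies.
  exact: twist_payoff.
- move=> Z [beta bB bZ]; exists (twist_strategy beta).
    exact: twist_Bstrategies.
  rewrite -[alpha]twist_strategyK; exact: twist_payoff.
Qed.

Lemma twist_upper_family i Y :
  let S := [set Y | exists2 beta, Bstrategies P Pi t beta &
         is_esssup P (Ffield i)
           [set Z | exists2 alpha, Astrategies P Pi t alpha &
              payoff f g P Pi i t x alpha beta Z] Y] in
  S Y -> S (Y \o h).
Proof.
move=> S [beta bB bY]; exists (twist_strategy beta).
  exact: twist_Bstrategies.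
apply: twist_esssup bY; first exact: (noise_sym_F hS (j := i)).
- move=> Z [alpha aA aZ]; exists (twist_strategy alpha).
    exact: twist_Astrategies.
  exact: twist_payoff.
- move=> Z [alpha aA aZ]; exists (twist_strategy alpha).
    exact: twist_Astrategies.
  rewrite -[beta]twist_strategyK; exact: twist_payoff.
Qed.

(** Both [Y] and [Y o h] are essential suprema of the same family. *)
Lemma esssup_invariant K S Y :
  K `<=` measurable ->
  (forall A, K A -> K (h @^-1` A)) -> (forall X, S X -> S (X \o h)) ->
  is_esssup P K S Y -> {ae P, forall w, Y (h w) = Y w}.
Proof.
move=> Km hKK SS YS.
have [YhK Yhub Yhlub] := twist_esssup hKK SS SS YS.
have [YK Yub Ylub] := YS.
have le1 := Yhlub Y (fun B mB => Km _ (YK B mB)) Yub.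
have le2 := Ylub (Y \o h) (fun B mB => Km _ (YhK B mB)) Yhub.
by apply: filterS2 le1 le2 => w /= ? ?; apply/eqP; rewrite eq_le; apply/andP.
Qed.

Lemma essinf_invariant K S Y :
  K `<=` measurable ->
  (forall A, K A -> K (h @^-1` A)) -> (forall X, S X -> S (X \o h)) ->
  is_essinf P K S Y -> {ae P, forall w, Y (h w) = Y w}.
Proof.
move=> Km hKK SS YS.
have [YhK Yhub Yhlub] := twist_essinf hKK SS SS YS.
have [YK Yub Ylub] := YS.
have le1 := Yhlub Y (fun B mB => Km _ (YK B mB)) Yub.
have le2 := Ylub (Y \o h) (fun B mB => Km _ (YhK B mB)) Yhub.
by apply: filterS2 le1 le2 => w /= ? ?; apply/eqP; rewrite eq_le; apply/andP.
Qed.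

End equivariance.

(** * Reflections of the circle *)

Section circle_reflections.
Variable R : realType.
Local Notation I01 := (unit_interval R).
Local Notation emb := (@unit_embed R : I01 -> measurableTypeR R).
Local Notation leb := (@lebesgue_measure R).
Implicit Types (a x c : R).

(** The map x |-> a - x mod 1, except that x = 1 is a fixed point when a < 1:
this makes it an involution of the closed interval, in which 0 and 1 are
distinct. *)
Definition circle_reflection a x : R :=
  if x <= a then a - x else if x < 1 then 1 + a - x else 1.

Lemma circle_reflection_itv a x :
  0 <= a <= 1 -> 0 <= x <= 1 -> 0 <= circle_reflection a x <= 1.
Proof.
move=> /andP[a0 a1] /andP[x0 x1]; rewrite /circle_reflection.
by have [xa|ax] := leP x a; last have [x1'|x1'] := ltP x 1; lra.
Qed.

Lemma circle_reflectionK a x : 0 <= a <= 1 -> 0 <= x <= 1 ->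
  circle_reflection a (circle_reflection a x) = x.
Proof.
move=> /andP[a0 a1] /andP[x0 x1]; rewrite /circle_reflection.
have [xa|ax] := leP x a.
  have -> : a - x <= a by lra.
  lra.
have [x1'|x1'] := ltP x 1.
  have -> : (1 + a - x <= a) = false by lra.
  have -> : 1 + a - x < 1 by lra.
  lra.
have -> : (1 <= a) = false by lra.
rewrite ltxx; lra.
Qed.

Lemma unit_embed_itv (x : I01) : 0 <= unit_embed x <= 1.
Proof. by rewrite /unit_embed; apply/andP; split. Qed.

Lemma unit_embed_inj : injective emb.
Proof. by move=> x y /val_inj. Qed.

Definition reflect01 (a x : I01) : I01 :=
  let h := andP (circle_reflection_itv (unit_embed_itv a) (unit_embed_itv x)) in
  Itv01 (proj1 h) (proj2 h).

Lemma unit_embed_reflect01 (a x : I01) :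
  unit_embed (reflect01 a x) = circle_reflection (unit_embed a) (unit_embed x).
Proof. by []. Qed.

Lemma reflect01K (a : I01) : involutive (reflect01 a).
Proof.
move=> x; apply: unit_embed_inj; rewrite !unit_embed_reflect01.
by rewrite circle_reflectionK// unit_embed_itv.
Qed.

Lemma measurable_unit_embed : measurable_fun setT emb.
Proof. by move=> _ B mB; exists B. Qed.

Lemma measurable_to_unit_interval d (X : measurableType d) (k : X -> I01) :
  measurable_fun setT (emb \o k) -> measurable_fun setT k.
Proof.
move=> mk _ _ [C mC <-]; rewrite !setTI.
by have := mk measurableT C mC; rewrite setTI.
Qed.

Lemma measurable_circle_reflection :
  measurable_fun setT (fun z : measurableTypeR R * measurableTypeR R =>
    circle_reflection z.1 z.2 : measurableTypeR R).
Proof.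
have m1 := @measurable_fst _ _ (measurableTypeR R) (measurableTypeR R).
have m2 := @measurable_snd _ _ (measurableTypeR R) (measurableTypeR R).
apply: measurable_fun_ifT; first exact: measurable_fun_ler.
  exact: measurable_funB.
apply: measurable_fun_ifT => //; first exact: measurable_fun_ltr.
by apply: measurable_funB => //; exact: measurable_funD.
Qed.

Lemma measurable_reflect01 :
  measurable_fun setT (fun z : I01 * I01 => reflect01 z.1 z.2).
Proof.
apply: measurable_to_unit_interval.
have mp : measurable_fun setT (fun z : I01 * I01 =>
    (unit_embed z.1, unit_embed z.2) : measurableTypeR R * measurableTypeR R).
  apply: measurable_fun_pair.
    exact: (measurableT_comp measurable_unit_embed measurable_fst).
  exact: (measurableT_comp measurable_unit_embed measurable_snd).
exact: (measurableT_comp measurable_circle_reflection mp).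
Qed.

Lemma lebesgue_measure_subl c (D : set (measurableTypeR R)) : measurable D ->
  leb [set x | D (c - x)] = leb D.
Proof.
pose r (x : measurableTypeR R) : measurableTypeR R := c - x.
have mr : measurable_fun setT r by exact: measurable_funB.
move=> mD; rewrite -[LHS]/(pushforward leb r D).
apply/esym/lebesgue_measure_unique => //= _ [[a b]] _ <-.
rewrite /pushforward (_ : _ @^-1` _ = `[c - b, c - a[%classic); last first.
  by apply/seteqP; split => x /=; rewrite /r !in_itv /=; lra.
rewrite !lebesgue_measure_itv/= !lte_fin.
have -> : (c - b < c - a) = (a < b) by lra.
by case: ifP => // _; rewrite -!EFinB; congr EFin; lra.
Qed.

(** A translation is the composition of two reflections. *)
Lemma lebesgue_measure_addr c (D : set (measurableTypeR R)) : measurable D ->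
  leb [set x | D (x + c)] = leb D.
Proof.
move=> mD; rewrite -(lebesgue_measure_subl 0 mD).
have mD' : measurable [set x : measurableTypeR R | D (0 - x)].
  have m0 : measurable_fun setT
      (fun x : measurableTypeR R => 0 - x : measurableTypeR R).
    exact: measurable_funB.
  exact: measurable_preimageT m0 mD.
rewrite -(lebesgue_measure_subl (- c) mD'); congr (leb _).
by apply/seteqP; split => x /=; congr D; lra.
Qed.

(** The pieces need to cover [0, 1] only up to the negligible point 1, which a
reflection of the circle may leave fixed. *)
Lemma lebesgue_measure_split (S I J : set (measurableTypeR R)) :
  measurable S -> measurable I -> measurable J ->
  S `<=` `[0, 1]%classic -> `[0, 1[%classic `<=` I `|` J -> I `&` J = set0 ->
  leb S = (leb (S `&` I) + leb (S `&` J))%E.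
Proof.
move=> mS mI mJ S01 IJ IJ0.
have mSI : measurable (S `&` I) by exact: measurableI.
have mSJ : measurable (S `&` J) by exact: measurableI.
rewrite -measureU//; last by rewrite setIACA setIid IJ0 setI0.
rewrite -setIUr.
rewrite -[in LHS](setUIDK S (I `|` J)) measureU//; last 3 first.
- by apply: measurableI => //; exact: measurableU.
- by apply: measurableD => //; exact: measurableU.
- by rewrite setIDA; apply/seteqP; split => x //= -[[[_ ?] _] ?].
rewrite [X in (_ + X)%E](_ : _ = 0%E) ?adde0//.
apply: (@subset_measure0 _ _ _ leb _ [set 1]) => //.
- by apply: measurableD => //; exact: measurableU.
- move=> x [Sx nIJ]; have := S01 x Sx; rewrite /= in_itv /= => /andP[x0].
  rewrite le_eqVlt => /orP[/eqP //|x1]; case: nIJ; apply: IJ.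
  by rewrite /= in_itv /= x0.
- exact: lebesgue_measure_set1.
Qed.

Lemma unit_embed_image (C : set (measurableTypeR R)) :
  emb @` (emb @^-1` C) = `[0, 1]%classic `&` C.
Proof.
apply/seteqP; split => [_ [x Cx <-]|x [x01 Cx]].
  by split; rewrite //= in_itv /= unit_embed_itv.
move: x01; rewrite /= in_itv /= => /andP[x0 x1].
by exists (Itv01 x0 x1 : I01).
Qed.

Lemma measurable_unit_embed_image (A : set I01) :
  measurable A -> measurable (emb @` A).
Proof.
move=> [C mC <-]; rewrite setTI unit_embed_image; exact: measurableI.
Qed.

Definition preserves01 (k : I01 -> I01) : Prop :=
  measurable_fun setT k /\
  forall A, measurable A ->
    leb (emb @` (k @^-1` A)) = leb (emb @` A).

Lemma unit_embed_image_itv (A : set I01) : emb @` A `<=` `[0, 1]%classic.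
Proof. by move=> _ [x _ <-]; rewrite /= in_itv /= unit_embed_itv. Qed.

(** The reflection exchanges the points of [0, a] by x |-> a - x and those of
]a, 1[ by x |-> 1 + a - x, so each of the two pieces is preserved. *)
Lemma preserves01_reflect01 (a : I01) : preserves01 (reflect01 a).
Proof.
have mr : measurable_fun setT (reflect01 a).
  exact: (measurableT_comp measurable_reflect01 (pair1_measurable a)).
split=> // A mA.
have mrA : measurable (reflect01 a @^-1` A).
  exact: measurable_preimageT.
have m1 := measurable_unit_embed_image mrA.
have m2 := measurable_unit_embed_image mA.
have /andP[a0 a1] := unit_embed_itv a.
set ra := unit_embed a in a0 a1.
have IJ : `[0, 1[%classic `<=` `[0, ra]%classic `|` `]ra, 1[%classic.
  by move=> x; rewrite /= !in_itv /=; have [xa|xa] := leP x ra; lra.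
have IJ0 : `[0, ra]%classic `&` `]ra, 1[%classic = set0 :> set R.
  by apply/seteqP; split=> x //= []; rewrite !in_itv /=; lra.
rewrite (lebesgue_measure_split m1 _ _ (@unit_embed_image_itv _) IJ IJ0)//.
rewrite (lebesgue_measure_split m2 _ _ (@unit_embed_image_itv _) IJ IJ0)//.
have mI1 : measurable (emb @` A `&` `[0, ra]%classic) by exact: measurableI.
have mI2 : measurable (emb @` A `&` `]ra, 1[%classic) by exact: measurableI.
rewrite -(lebesgue_measure_subl ra mI1) -(lebesgue_measure_subl (1 + ra) mI2).
congr (leb _ + leb _)%E; apply/seteqP; split=> x /=; rewrite !in_itv /=.
- move=> [[z Az <-] xI]; split; last by lra.
  exists (reflect01 a z) => //; rewrite unit_embed_reflect01 /circle_reflection.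
  by rewrite -/ra; have -> : unit_embed z <= ra by lra.
- move=> [[y Ay yx] xI]; split; last by lra.
  exists (reflect01 a y); first by rewrite /= reflect01K.
  rewrite unit_embed_reflect01 /circle_reflection yx -/ra.
  have -> : ra - x <= ra by lra.
  lra.
- move=> [[z Az <-] xI]; split; last by lra.
  exists (reflect01 a z) => //; rewrite unit_embed_reflect01 /circle_reflection.
  rewrite -/ra; have -> : (unit_embed z <= ra) = false by lra.
  by have -> : unit_embed z < 1 by lra.
- move=> [[y Ay yx] xI]; split; last by lra.
  exists (reflect01 a y); first by rewrite /= reflect01K.
  rewrite unit_embed_reflect01 /circle_reflection yx -/ra.
  have -> : (1 + ra - x <= ra) = false by lra.
  have -> : 1 + ra - x < 1 by lra.
  lra.
Qed.

(** As a function of a, the reflection a - x mod 1 is a rotation: it carries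
[x, 1[ onto [0, 1 - x[ and [0, x[ onto [1 - x, 1[.  This fails for x = 1,
where the reflection was modified. *)
Lemma preserves01_reflect01_center (x : I01) : unit_embed x < 1 ->
  preserves01 (reflect01^~ x).
Proof.
move=> x1.
have mr : measurable_fun setT (reflect01^~ x).
  exact: (measurableT_comp measurable_reflect01 (pair2_measurable x)).
split=> // A mA.
have mrA : measurable (reflect01^~ x @^-1` A).
  exact: measurable_preimageT.
have m1 := measurable_unit_embed_image mrA.
have m2 := measurable_unit_embed_image mA.
have /andP[x0 _] := unit_embed_itv x.
set rx := unit_embed x in x0 x1.
have IJ : `[0, 1[%classic `<=` `[rx, 1[%classic `|` `[0, rx[%classic.
  by move=> b; rewrite /= !in_itv /=; have [xa|xa] := leP rx b; lra.
have IJ0 : `[rx, 1[%classic `&` `[0, rx[%classic = set0 :> set R.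
  by apply/seteqP; split=> b //= []; rewrite !in_itv /=; lra.
have IJ' : `[0, 1[%classic `<=` `[0, 1 - rx[%classic `|` `[1 - rx, 1[%classic.
  by move=> b; rewrite /= !in_itv /=; have [xa|xa] := leP (1 - rx) b; lra.
have IJ0' : `[0, 1 - rx[%classic `&` `[1 - rx, 1[%classic = set0 :> set R.
  by apply/seteqP; split=> b //= []; rewrite !in_itv /=; lra.
rewrite (lebesgue_measure_split m1 _ _ (@unit_embed_image_itv _) IJ IJ0)//.
rewrite (lebesgue_measure_split m2 _ _ (@unit_embed_image_itv _) IJ' IJ0')//.
have mI1 : measurable (emb @` A `&` `[0, 1 - rx[%classic) by exact: measurableI.
have mI2 : measurable (emb @` A `&` `[1 - rx, 1[%classic) by exact: measurableI.
rewrite -(lebesgue_measure_addr (- rx) mI1).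
rewrite -(lebesgue_measure_addr (1 - rx) mI2).
congr (leb _ + leb _)%E; apply/seteqP; split=> b /=; rewrite !in_itv /=.
- move=> [[z Az <-] bI]; split; last by lra.
  exists (reflect01 z x) => //; rewrite unit_embed_reflect01 /circle_reflection.
  by rewrite -/rx; have -> : rx <= unit_embed z by lra.
- move=> [[y Ay yb] bI]; split; last by lra.
  have b0 : 0 <= b by lra.
  have b1 : b <= 1 by lra.
  exists (Itv01 b0 b1) => //=; rewrite (_ : reflect01 _ _ = y)//.
  apply: unit_embed_inj; rewrite unit_embed_reflect01 /circle_reflection yb -/rx.
  have -> // : rx <= unit_embed (Itv01 b0 b1 : I01).
  by rewrite /unit_embed /=; lra.
- move=> [[z Az <-] bI]; split; last by lra.
  exists (reflect01 z x) => //; rewrite unit_embed_reflect01 /circle_reflection.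
  rewrite -/rx; have -> : (rx <= unit_embed z) = false by lra.
  by rewrite x1; lra.
- move=> [[y Ay yb] bI]; split; last by lra.
  have b0 : 0 <= b by lra.
  have b1 : b <= 1 by lra.
  exists (Itv01 b0 b1) => //=; rewrite (_ : reflect01 _ _ = y)//.
  apply: unit_embed_inj; rewrite unit_embed_reflect01 /circle_reflection yb -/rx.
  have -> : (rx <= unit_embed (Itv01 b0 b1 : I01)) = false.
    by rewrite /unit_embed /=; lra.
  by rewrite x1 /unit_embed /=; lra.
Qed.

End circle_reflections.

(** * Coordinatewise maps of the noise *)

Lemma same_law d d' (X : measurableType d) (Y : measurableType d')
    (R : realType) (P : probability X R) (h1 h2 : X -> Y) (G : set_system Y) :
  measurable_fun setT h1 -> measurable_fun setT h2 ->
  @measurable _ Y = <<s G >> -> setI_closed G -> G setT ->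
  (forall A, G A -> P (h1 @^-1` A) = P (h2 @^-1` A)) ->
  forall A, measurable A -> P (h1 @^-1` A) = P (h2 @^-1` A).
Proof.
move=> mh1 mh2 mG GI GT PG A mA.
pose m1 : {measure set Y -> \bar R} := pushforward P h1.
pose m2 : {measure set Y -> \bar R} := pushforward P h2.
rewrite -[LHS]/(m1 mh1 A) -[RHS]/(m2 mh2 A).
apply: (measure_unique G (fun=> setT)) => //; first by rewrite bigcup_const.
by move=> _; rewrite /= /pushforward preimage_setT probability_setT ltry.
Qed.

Section coordinatewise_maps.
Variable R : realType.
Local Notation I01 := (unit_interval R).
Local Notation Omega := (Omega R).
Local Notation emb := (@unit_embed R : I01 -> measurableTypeR R).
Local Notation leb := (@lebesgue_measure R).

Lemma measurable_zeta k : measurable_fun setT (@zeta R k).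
Proof.
move=> _ B mB; rewrite setTI; apply: sub_sigma_algebra.
by exists k => //; exists B => //; rewrite setTI.
Qed.

Lemma measurable_to_Omega d (X : measurableType d) (h : X -> Omega) :
  (forall k, measurable_fun setT (zeta k \o h)) -> measurable_fun setT h.
Proof.
move=> mh; apply: (@measurability _ _ X Omega setT h
  (\bigcup_k preimage_set_system setT (fun w : nat -> unit_square R => w k)
     measurable)) => //.
move=> _ [_ [k _ [B mB <-]] <-]; rewrite !setTI.
by have := mh k measurableT B mB; rewrite setTI.
Qed.

Definition coordinatewise (phi psi : nat -> I01 -> I01) (w : Omega) : Omega :=
  fun k => (phi k (w k).1, psi k (w k).2).

Variables phi psi : nat -> I01 -> I01.
Hypotheses (mphi : forall k, measurable_fun setT (phi k)).
Hypotheses (mpsi : forall k, measurable_fun setT (psi k)).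
Local Notation h := (coordinatewise phi psi).

Let sq k (z : unit_square R) : unit_square R := (phi k z.1, psi k z.2).

Let measurable_sq k : measurable_fun setT (sq k).
Proof.
apply: measurable_fun_pair.
  exact: (measurableT_comp (mphi k) measurable_fst).
exact: (measurableT_comp (mpsi k) measurable_snd).
Qed.

Let measurable_sq_preimage k (B : set (unit_square R)) :
  measurable B -> measurable (sq k @^-1` B).
Proof. exact: measurable_preimageT (@measurable_sq k). Qed.

Lemma measurable_coordinatewise : measurable_fun setT h.
Proof.
apply: measurable_to_Omega => k.
exact: (measurableT_comp (@measurable_sq k) (@measurable_zeta k)).
Qed.

Lemma coordinatewise_F j A : Ffield j A -> Ffield j (h @^-1` A).
Proof.
have sF : sigma_algebra setT (image_set_system setT h (@Ffield R j)).
  by apply: sigma_algebra_image; exact: smallest_sigma_algebra.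
move=> FA; have : image_set_system setT h (@Ffield R j) A.
  apply: smallest_sub FA => // _ [k kj [B mB <-]].
  rewrite /image_set_system /= !setTI; apply: sub_sigma_algebra.
  exists k => //; exists (sq k @^-1` B); first exact: measurable_sq_preimage.
  by rewrite setTI.
by rewrite /image_set_system /= setTI.
Qed.

Lemma coordinatewise_G k A : Gfield k A -> Gfield k (h @^-1` A).
Proof.
move=> [B mB <-]; exists (phi k @^-1` B); last by rewrite !setTI.
exact: measurable_preimageT (mphi k) mB.
Qed.

Lemma coordinatewise_H k A : Hfield k A -> Hfield k (h @^-1` A).
Proof.
move=> [B mB <-]; exists (psi k @^-1` B); last by rewrite !setTI.
exact: measurable_preimageT (mpsi k) mB.
Qed.

Variable P : probability Omega R.
Hypothesis P_product : is_product_measure P.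

(** The law of the first coordinate makes a genuine measure out of
[lambda2]. *)
Lemma lambda2_zeta (B : set (unit_square R)) :
  measurable B -> lambda2 B = P (zeta 0 @^-1` B).
Proof.
move=> mB; have := @P_product 1%N (fun=> B) (fun=> mB).
rewrite big_ord_recl big_ord0 mule1 => <-; congr (P _).
by apply/seteqP; split=> [w|w Bw [|//] _ //]; apply.
Qed.

Lemma lambda2_setX (A B : set I01) : measurable A -> measurable B ->
  lambda2 (A `*` B) = (leb (emb @` A) * leb (emb @` B))%E.
Proof.
move=> mA mB; rewrite /lambda2.
rewrite -product_measure1E; try exact: measurable_unit_embed_image.
congr (product_measure1 _ _ _); apply/seteqP; split=> [_ [[a b] [Aa Bb] <-]|].
  by split => /=; [exists a|exists b].
by move=> [_ _] /= [[a Aa <-] [b Bb <-]]; exists (a, b).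
Qed.

Hypotheses (phi01 : forall k, preserves01 (phi k)).
Hypotheses (psi01 : forall k, preserves01 (psi k)).

Let lambda2_preserved k (B : set (unit_square R)) :
  measurable B -> lambda2 (sq k @^-1` B) = lambda2 B.
Proof.
move=> mB; rewrite !lambda2_zeta//; last exact: measurable_sq_preimage.
have mz := @measurable_zeta 0.
have msz : measurable_fun setT (sq k \o zeta 0).
  exact: (measurableT_comp (@measurable_sq k) mz).
apply: (same_law (G := [set A `*` B | A in measurable & B in measurable])
  msz mz) => //.
- exact: measurable_prod_measurableType.
- move=> _ _ [A1 mA1 [B1 mB1 <-]] [A2 mA2 [B2 mB2 <-]].
  exists (A1 `&` A2); first exact: measurableI.
  by exists (B1 `&` B2); [exact: measurableI|rewrite setXI].
- by exists setT => //; exists setT => //; rewrite setXTT.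
- move=> _ [A1 mA1 [A2 mA2 <-]].
  have mA1' := measurable_preimageT (mphi k) mA1.
  have mA2' := measurable_preimageT (mpsi k) mA2.
  rewrite -[RHS]lambda2_zeta; last exact: measurableX.
  rewrite -[LHS]/(P (zeta 0 @^-1` (phi k @^-1` A1 `*` psi k @^-1` A2))).
  rewrite -lambda2_zeta; last exact: measurableX.
  by rewrite !lambda2_setX// (phi01 k).2// (psi01 k).2.
Qed.

Lemma lambda2_setT : lambda2 setT = 1%E :> \bar R.
Proof. by rewrite lambda2_zeta// preimage_setT probability_setT. Qed.

Definition cylinder (A : set Omega) : Prop :=
  exists n (B : nat -> set (unit_square R)),
  (forall k, measurable (B k)) /\ A = \bigcap_(k in `I_n) zeta k @^-1` B k.

Lemma cylinderI : setI_closed cylinder.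
Proof.
move=> _ _ [n [B [mB ->]]] [m [C [mC ->]]].
exists (maxn n m), (fun k => (if (k < n)%N then B k else setT) `&`
  (if (k < m)%N then C k else setT)); split.
  by move=> k; apply: measurableI; case: ifP.
apply/seteqP; split=> [w [Bw Cw] k _|w BCw].
  by split; case: ifP => // km; [exact: Bw|exact: Cw].
split=> k /= km; have [] := BCw k; rewrite ?km// /= leq_max km ?orbT//.
Qed.

Lemma measurable_cylinder : @measurable _ Omega = <<s cylinder >>.
Proof.
apply/seteqP; split.
  apply: smallest_sub; first exact: smallest_sigma_algebra.
  move=> _ [k _ [B mB <-]]; apply: sub_sigma_algebra; rewrite setTI.
  exists k.+1, (fun j => if j == k then B else setT); split.
    by move=> j; case: ifP.
  apply/seteqP; split=> [w Bw j _|w Bw]; first by rewrite /=; case: eqP => [->|].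
  by have := Bw k (ltnSn k); rewrite /= eqxx.
apply: smallest_sub; first exact: sigma_algebra_measurable.
move=> _ [n [B [mB ->]]]; apply: bigcap_measurableType => k _.
exact: measurable_preimageT (@measurable_zeta k) (mB k).
Qed.

(** By uniqueness of measures on the pi-system of cylinders, on which the
product structure of [P] is explicit. *)
Lemma coordinatewise_preserving A : measurable A -> P (h @^-1` A) = P A.
Proof.
apply: (same_law (G := cylinder) measurable_coordinatewise
  (@measurable_id _ _ setT)).
- exact: measurable_cylinder.
- exact: cylinderI.
- exists 0%N, (fun=> setT); split=> //.
  by apply/seteqP; split.
- move=> _ [n [B [mB ->]]]; rewrite preimage_id P_product//.
  rewrite [X in P X](_ : _ = \bigcap_(k in `I_n) zeta k @^-1` (sq k @^-1` B k)).
    rewrite P_product; last by move=> k; exact: measurable_sq_preimage.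
    by apply: eq_bigr => k _; exact: lambda2_preserved.
  by apply/seteqP; split.
Qed.

Lemma zeta_lambda2 k (B : set (unit_square R)) :
  measurable B -> P (zeta k @^-1` B) = lambda2 B.
Proof.
move=> mB; pose C j := if j == k then B else setT.
have mC j : measurable (C j) by rewrite /C; case: ifP.
have := P_product k.+1 mC; rewrite big_ord_recr /= big1 ?mul1e; last first.
  by move=> j _; rewrite /C ltn_eqF// lambda2_setT.
rewrite {2}/C eqxx => <-; congr (P _).
apply/seteqP; split=> [w Bw j _|w Bw]; first by rewrite /C /=; case: eqP => [->|].
by have := Bw k (ltnSn k); rewrite /C /= eqxx.
Qed.

Let endpoint : set I01 := emb @^-1` [set 1].

Let measurable_endpoint : measurable endpoint.
Proof. by exists [set 1] => //; rewrite setTI. Qed.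

Let endpoint_null : leb (emb @` endpoint) = 0%E.
Proof.
rewrite unit_embed_image; apply: (@subset_measure0 _ _ _ leb _ [set 1]) => //=.
- exact: measurableI.
- exact: lebesgue_measure_set1.
Qed.

Let lt1_endpoint (x : I01) : ~ unit_embed x < 1 -> endpoint x.
Proof.
by move=> x1; have := unit_embed_itv x; rewrite /endpoint /=; lra.
Qed.

(** Hence almost surely every component x of the noise is such that
[reflect01^~ x] preserves Lebesgue measure. *)
Lemma ae_unit_embed_lt1 : {ae P, forall w : Omega, forall k,
  unit_embed (w k).1 < 1 /\ unit_embed (w k).2 < 1}.
Proof.
apply: ae_foralln => k.
have ae1 : {ae P, forall w : Omega, unit_embed (w k).1 < 1}.
  exists (zeta k @^-1` (endpoint `*` setT)); split.
  - by apply: measurable_preimageT; [exact: measurable_zeta|exact: measurableX].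
  - rewrite zeta_lambda2; last exact: measurableX.
    by rewrite lambda2_setX// endpoint_null mul0e.
  - by move=> w /= /lt1_endpoint.
have ae2 : {ae P, forall w : Omega, unit_embed (w k).2 < 1}.
  exists (zeta k @^-1` (setT `*` endpoint)); split.
  - by apply: measurable_preimageT; [exact: measurable_zeta|exact: measurableX].
  - rewrite zeta_lambda2; last exact: measurableX.
    by rewrite lambda2_setX// endpoint_null mule0.
  - by move=> w /= /lt1_endpoint.
by apply: filterS2 ae1 ae2.
Qed.

End coordinatewise_maps.
(** * Invariant random variables are constant *)

Section constancy.
Context d (X : measurableType d) (R : realType) (P : probability X R).

Lemma ae_exists (Q : X -> Prop) : {ae P, forall x, Q x} -> exists x, Q x.
Proof.
move=> [N [mN N0 QN]]; apply/not_existsP => nQ.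
have NT : N = setT by apply/seteqP; split=> // x _; apply: QN; exact: nQ.
by move: N0; rewrite NT probability_setT => /eqP; rewrite onee_eq0.
Qed.

(** Fubini: a set whose sections in one direction are all null has almost all
its sections in the other direction null. *)
Lemma ae_swap (N : set (X * X)) : measurable N ->
  (forall a, P (xsection N a) = 0%E) ->
  {ae P, forall w, P (ysection N w) = 0%E}.
Proof.
move=> mN N0.
have N20 : (P \x^ P)%E N = 0%E.
  have <- : (P \x P)%E N = (P \x^ P)%E N.
    apply: product_measure_unique => // A B mA mB; exact: product_measure2E.
  by rewrite /product_measure1; apply: integral0_eq => a _ /=; rewrite N0.
have mf : measurable_fun setT (P \o ysection N) by exact: measurable_fun_ysection.
have [+ _] := ae_eq_integral_abs P measurableT mf.
rewrite (eq_integral (P \o ysection N)); last by move=> w _; rewrite gee0_abs.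
by move=> /(_ N20); apply: filterS => w /(_ I).
Qed.

(** For almost every [w], the function a |-> W (h (a, w)) has the law of [W]
and is almost surely equal to the number [W w]. *)
Lemma ae_constant_of_invariant (h : X * X -> X) (W : X -> R) :
  measurable_fun setT h -> measurable_fun setT W ->
  (forall a, {ae P, forall w, W (h (a, w)) = W w}) ->
  {ae P, forall w, forall A, measurable A ->
     P ((fun a => h (a, w)) @^-1` A) = P A} ->
  exists c, {ae P, forall w, W w = c}.
Proof.
move=> mh mW Winv hP.
pose N := [set z | W (h z) != W z.2].
have mN : measurable N.
  have := @measurable_fun_eqr _ _ R setT _ _ (measurableT_comp mW mh)
    (measurableT_comp mW (@measurable_snd _ _ X X)).
  move=> /(_ measurableT [set false]); rewrite setTI => /(_ I).
  rewrite (_ : _ @^-1` _ = N)//.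
  by apply/seteqP; split=> z; rewrite /N /=; case: eqP.
have N0 a : P (xsection N a) = 0%E.
  have [M [mM M0 WM]] := Winv a.
  apply: (@subset_measure0 _ _ _ P _ M) => //; first exact: measurable_xsection.
  by move=> w; rewrite /xsection /= inE => /eqP; exact: WM.
have [w [Nw hw]] := ae_exists (filterI (ae_swap mN N0) hP).
exists (W w); exists (W @^-1` ~` [set W w]).
have mWw : measurable (W @^-1` ~` [set W w]).
  by apply: measurable_preimageT => //; exact: measurableC.
split=> //; rewrite -hw// -[RHS]Nw; congr (P _).
by apply/seteqP; split=> a; rewrite /ysection /= inE /N /= => /eqP.
Qed.

Lemma expectation_ae_constant (W : X -> R) c : measurable_fun setT W ->
  {ae P, forall w, W w = c} -> {ae P, forall w, (W w)%:E = 'E_P[W]%E}.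
Proof.
move=> mW Wc; have -> : 'E_P[W]%E = c%:E.
  rewrite unlock (ae_eq_integral (EFin \o cst c)) //=.
  - by rewrite integral_cst//= probability_setT mule1.
  - exact/measurable_EFinP.
  - by apply/measurable_EFinP; exact: measurable_cst.
  - by apply: filterS Wc => w /= -> _.
by apply: filterS Wc => w ->.
Qed.

End constancy.

Section reflected_noise.
Variables (R : realType) (P : probability (Omega R) R).
Hypothesis P_product : is_product_measure P.
Local Notation Omega := (Omega R).

Definition reflect_noise (z : Omega * Omega) : Omega :=
  fun k => (reflect01 (z.1 k).1 (z.2 k).1, reflect01 (z.1 k).2 (z.2 k).2).

Lemma measurable_reflect_noise : measurable_fun setT reflect_noise.
Proof.
apply: measurable_to_Omega => k.
have mz1 := measurableT_comp (@measurable_zeta R k)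
  (@measurable_fst _ _ Omega Omega).
have mz2 := measurableT_comp (@measurable_zeta R k)
  (@measurable_snd _ _ Omega Omega).
have m1 := measurable_fun_pair (measurableT_comp measurable_fst mz1)
  (measurableT_comp measurable_fst mz2).
have m2 := measurable_fun_pair (measurableT_comp measurable_snd mz1)
  (measurableT_comp measurable_snd mz2).
exact: (measurable_fun_pair (measurableT_comp (@measurable_reflect01 R) m1)
  (measurableT_comp (@measurable_reflect01 R) m2)).
Qed.

Lemma noise_symmetry_reflect (a : Omega) :
  noise_symmetry P (fun w => reflect_noise (a, w)).
Proof.
pose phi k := reflect01 (a k).1; pose psi k := reflect01 (a k).2.
have phi01 k : preserves01 (phi k) by exact: preserves01_reflect01.
have psi01 k : preserves01 (psi k) by exact: preserves01_reflect01.
have mphi k := (phi01 k).1.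
have mpsi k := (psi01 k).1.
rewrite (_ : (fun w => _) = coordinatewise phi psi)//; split.
- move=> w; apply/funext => k; rewrite /coordinatewise /phi /psi /= !reflect01K.
  by case: (w k).
- by move=> A; apply: measurable_preimageT; exact: measurable_coordinatewise.
- exact: (coordinatewise_preserving mphi mpsi P_product phi01 psi01).
- exact: (coordinatewise_F mphi mpsi).
- by move=> k A; exact: coordinatewise_G.
- by move=> k A; exact: coordinatewise_H.
Qed.

Lemma reflect_noise_center_preserving : {ae P, forall w, forall A, measurable A ->
  P ((fun a => reflect_noise (a, w)) @^-1` A) = P A}.
Proof.
apply: filterS (ae_unit_embed_lt1 P_product) => w w1.
pose phi k x := reflect01 x (w k).1; pose psi k x := reflect01 x (w k).2.
have phi01 k : preserves01 (phi k).
  by apply: preserves01_reflect01_center; have [] := w1 k.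
have psi01 k : preserves01 (psi k).
  by apply: preserves01_reflect01_center; have [] := w1 k.
exact: (coordinatewise_preserving (fun k => (phi01 k).1) (fun k => (psi01 k).1)
  P_product phi01 psi01).
Qed.

Lemma Ffield_measurable i : @Ffield R i `<=` measurable.
Proof.
apply: smallest_sub; first exact: sigma_algebra_measurable.
by move=> A [k _ kA]; apply: sub_sigma_algebra; exists k.
Qed.

Lemma deterministic_of_invariant i (W : Omega -> R) : rv_wrt (Ffield i) W ->
  (forall h, noise_symmetry P h -> {ae P, forall w, W (h w) = W w}) ->
  {ae P, forall w, (W w)%:E = 'E_P[W]%E}.
Proof.
move=> WF Winv.
have mW : measurable_fun setT W.
  by move=> _ B mB; rewrite setTI; exact: Ffield_measurable (WF B mB).
have [c Wc] := ae_constant_of_invariant measurable_reflect_noise mW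
  (fun a => Winv _ (noise_symmetry_reflect a)) reflect_noise_center_preserving.
exact: expectation_ae_constant mW Wc.
Qed.

End reflected_noise.

Theorem theorem3p2 (R : realType) (d : nat) (U V : metricType R) (T : R)
  (f : R -> 'rV[R]_d.+1 -> U -> V -> 'rV[R]_d.+1) (g : 'rV[R]_d.+1 -> R)
  (P : probability (Omega R) R)
  (T_gt0 : 0 < T)
  (U_compact : compact [set: U]) (U_nonempty : [set: U] !=set0)
  (V_compact : compact [set: V]) (V_nonempty : [set: V] !=set0)
  (f_bounded : exists M : R, forall (t : R) x u v, 0 <= t <= T -> `|f t x u v| <= M)
  (f_continuous : {within [set z | 0 <= z.1.1.1 <= T],
     continuous (fun z : R * 'rV[R]_d.+1 * U * V =>
                   f z.1.1.1 z.1.1.2 z.1.2 z.2)})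
  (f_lipschitz : exists L : R, forall (t : R) x y u v, 0 <= t <= T ->
     `|f t x u v - f t y u v| <= L * `|x - y|)
  (g_bounded : exists M : R, forall x, `|g x| <= M)
  (g_lipschitz : exists L : R, forall x y, `|g x - g y| <= L * `|x - y|)
  (P_product : is_product_measure P)
  (Pi : time_partition T) (t : R) (x : 'rV[R]_d.+1) (t_range : 0 <= t <= T) :
  (forall W : Omega R -> R, is_lower_value f g P Pi t x W ->
     {ae P, forall w, (W w)%:E = 'E_P[W]%E}) /\
  (forall W : Omega R -> R, is_upper_value f g P Pi t x W ->
     {ae P, forall w, (W w)%:E = 'E_P[W]%E}).
Proof.
split=> W [[_ ->]|[i [_ _ WS]]].
- apply: (expectation_ae_constant (c := g x)); first exact: measurable_cst.
  by apply: filterE.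
- have [WF _ _] := WS.
  apply: (deterministic_of_invariant P_product WF) => h hS.
  apply: (esssup_invariant hS (@Ffield_measurable R i) _ _ WS).
    exact: (noise_sym_F hS (j := i)).
  exact: (twist_lower_family hS).
- apply: (expectation_ae_constant (c := g x)); first exact: measurable_cst.
  by apply: filterE.
- have [WF _ _] := WS.
  apply: (deterministic_of_invariant P_product WF) => h hS.
  apply: (essinf_invariant hS (@Ffield_measurable R i) _ _ WS).
    exact: (noise_sym_F hS (j := i)).
  exact: (twist_upper_family hS).
Qed.
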